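(* Let $q$ be an indeterminate and for every integer $k\ge 0$ let \[ c_q(k)=\frac{(q;q^2)_{k}^2\, (q;q^2)_{2k}}{(q^6;q^6)_{k}^2\, (q^2;q^2)_{2k}}\, [8k+1]\, q^{2k^2}, \] and \[ a_q(k)=\sum_{j=0}^{k} c_q(j)\, c_q(k-j). \] Then for every positive integer $n$ coprime to $6$, \[ \sum_{k=0}^{n-1} a_q(k)\equiv q^{-(n-1)}[n]^2 \pmod{[n]\Phi_n(q)^2}. \]
   Context: The $q$-shifted factorial is $(x;q)_0=1$ and $(x;q)_m=\prod_{i=0}^{m-1}(1-xq^i)$ for $m\ge1$. The $q$-integer is $[n]=\frac{1-q^n}{1-q}=1+q+\cdots+q^{n-1}$. $\Phi_n(q)=\prod_{1\le j\le n,\ \gcd(j,n)=1}(q-\zeta^j)$ with $\zeta=e^{2\pi i/n}$ is the $n$-th cyclotomic polynomial. For polynomials $A_1(q),A_2(q),P(q)\in\mathbb{Z}[q]$, $\frac{A_1(q)}{A_2(q)}\equiv 0 \pmod{P(q)}$ means $P(q)$ divides $A_1(q)$ and $\gcd(P(q),A_2(q))=1$; for rational functions $A(q),B(q)\in\mathbb{Z}(q)$, $A(q)\equiv B(q)\pmod{P(q)}$ means $A(q)-B(q)\equiv 0\pmod{P(q)}$. *)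

(* Defs.v *)
From mathcomp Require Import all_boot all_order all_algebra all_field.

Set Implicit Arguments.
Unset Strict Implicit.
Unset Printing Implicit Defensive.

Import GRing.Theory.
Local Open Scope ring_scope.

Notation "x %:F" := (tofrac x) : ring_scope.

(* Z(q), as the fraction field of Z[q]. *)
Definition ratfun := {fraction {poly int}}.

(* The indeterminate q, as an element of Z(q). *)
Definition q : ratfun := ('X : {poly int})%:F.

Definition qpoch (R : pzRingType) (x t : R) (m : nat) : R :=
  \prod_(i < m) (1 - x * t ^+ i).

(* [n] = 1 + q + ... + q^(n-1), kept in Z[q] because it occurs in the modulus;
   qintE is the quotient form. *)
Definition qint (n : nat) : {poly int} := \sum_(i < n) 'X^i.

Lemma qintE (n : nat) : (qint n)%:F = (1 - q ^+ n) / (1 - q) :> ratfun.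
Proof.
have nz : 1 - q != 0.
  rewrite -opprB oppr_eq0 /q -(rmorph1 (@tofrac {poly int})) -rmorphB /=.
  by rewrite tofrac_eq0 polyXsubC_eq0.
apply: (canRL (mulfK nz)).
rewrite -opprB mulrN mulrC -[1 - _]opprB; congr (- _).
by rewrite /q -(rmorph1 (@tofrac {poly int})) -rmorphXn -!rmorphB -rmorphM /=
           subrX1.
Qed.

(* Divisibility and coprimality inside the ring Z[q].  The library's %| and
   coprimep on {poly int} are pseudo-division notions that ignore integer
   factors: they amount to the notions of Q[q]. *)
Definition zdvdp (P A : {poly int}) : Prop := exists B : {poly int}, A = P * B.

Definition zcoprimep (P A : {poly int}) : Prop :=
  forall D : {poly int}, zdvdp D P -> zdvdp D A -> D \is a GRing.unit.

(* Being 0 modulo P is a property of the rational function A, hence the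
   existential over its representations A1 / A2; if some representation
   qualifies then so does the one in lowest terms. *)
Definition ratfun_eq0_mod (P : {poly int}) (A : ratfun) : Prop :=
  exists A1 A2 : {poly int},
    [/\ A2 != 0, A = A1%:F / A2%:F, zdvdp P A1 & zcoprimep P A2].

Definition ratfun_eq_mod (P : {poly int}) (A B : ratfun) : Prop :=
  ratfun_eq0_mod P (A - B).

Definition c_q (k : nat) : ratfun :=
  (qpoch q (q ^+ 2) k ^+ 2 * qpoch q (q ^+ 2) (2 * k))
    / (qpoch (q ^+ 6) (q ^+ 6) k ^+ 2 * qpoch (q ^+ 2) (q ^+ 2) (2 * k))
  * (qint (8 * k + 1))%:F * q ^+ (2 * k ^ 2).

Definition a_q (k : nat) : ratfun := \sum_(j < k.+1) c_q j * c_q (k - j).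

(* Main.v *)
(** Write S for the sum of c_q over 0 <= k < n.  Modulo Phi_n^2 the factors
    (1 - q^m)^2 of c_q can be replaced by (1 - q^(m-n)) (1 - q^(m+n)), because
    the two differ by q^(m-n) (1 - q^n)^2.  The resulting sum terminates and is
    evaluated exactly by a WZ pair in y = q^n, with step n -> n + 6; its value is
    +- q^(-(n-1)/2) [n].  As this is divisible by Phi_n, knowing S modulo Phi_n^2
    suffices to know S^2 modulo Phi_n^3.

    For d | n, with i = d u + r, the exponents of Phi_d in c_q i and c_q j add up
    to at least 3 as soon as (i mod d) + (j mod d) >= d.  Hence, modulo Phi_d^3,
    the range j < n - i of the triangular sum of the a_q can be extended to
    j < n - d u.  For d = n this gives S^2; for d < n it is a union of complete
    blocks of length d, and each block vanishes modulo Phi_d since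
    c_q (d u + r) is congruent to a multiple, independent of r, of c_q r. *)
Require Import Defs.
From mathcomp Require Import all_boot all_order all_algebra all_field.
From mathcomp Require Import ring zify.

Set Implicit Arguments.
Unset Strict Implicit.
Unset Printing Implicit Defensive.

Import GRing.Theory Num.Theory.
Local Open Scope ring_scope.

(** * The terminating sum *)

Lemma qpochS (R : pzRingType) (x t : R) m :
  qpoch x t m.+1 = qpoch x t m * (1 - x * t ^+ m).
Proof. exact: big_ord_recr. Qed.

Lemma qpoch0 (R : pzRingType) (x t : R) : qpoch x t 0 = 1.
Proof. exact: big_ord0. Qed.

Lemma qpoch_shift (R : comPzRingType) (x t : R) m :
  (1 - x) * qpoch (x * t) t m = qpoch x t m * (1 - x * t ^+ m).
Proof.
rewrite -qpochS /qpoch big_ord_recl expr0 mulr1; congr (_ * _).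
by apply: eq_bigr => i _; rewrite -mulrA -exprS.
Qed.

(** The substitution y -> q^6 y moves a factorial of base q^2 by three places, and one of base q^6
    by a single place. *)
Lemma qpoch_shift3 (R : comPzRingType) (x t : R) m :
  (1 - x) * (1 - x * t) * (1 - x * t ^+ 2) * qpoch (x * t ^+ 3) t m
  = qpoch x t m * (1 - x * t ^+ m) * (1 - x * t * t ^+ m)
    * (1 - x * t ^+ 2 * t ^+ m).
Proof.
have h1 := qpoch_shift x t m.
have := qpoch_shift (x * t) t m; rewrite -mulrA -expr2 => h2.
have := qpoch_shift (x * t ^+ 2) t m; rewrite -mulrA -exprSr => h3.
rewrite -mulrA h3 mulrA -(mulrA (1 - x)) h2 mulrA h1.
by rewrite !mulrA.
Qed.

(** A deformation of (1 - q) c_q(k): each square (x;t)_k^2 becomes (x/y;t)_k (xy;t)_k, and y = 1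
    gives it back. *)
Definition qterm (F : fieldType) (q y : F) (k : nat) : F :=
  qpoch (q / y) (q ^+ 2) k * qpoch (q * y) (q ^+ 2) k * qpoch q (q ^+ 2) (2 * k)
  * (1 - q ^+ (8 * k + 1)) * q ^+ (2 * k ^ 2)
  / (qpoch (q ^+ 6 / y) (q ^+ 6) k * qpoch (q ^+ 6 * y) (q ^+ 6) k
     * qpoch (q ^+ 2) (q ^+ 2) (2 * k)).

(* The rational function [qcert / qterm] was found by interpolating the partial
   sums of q^3 (1 - y) qterm(q^6 y) - (1 - q^6 y) qterm(y) in X = q^(2k). *)
Definition qcert (F : fieldType) (q y : F) (k : nat) : F :=
  (1 - q ^+ 6 * y ^+ 2) * (1 - q ^+ 6 * y) * q ^+ 3 * y
  / ((1 - q ^+ 5 * y) * (1 - q ^+ 3 * y) * (1 - q * y))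
  * qpoch (q ^- 5 / y) (q ^+ 2) k * qpoch (q * y) (q ^+ 2) k
  * qpoch q (q ^+ 2) (2 * k) * q ^+ (2 * k ^ 2)
  * (1 - q ^+ (4 * k)) * (1 - q ^+ (4 * k) / q ^+ 2)
  * (1 - q ^+ (6 * k) / y)
  / (qpoch (q ^+ 6 / y) (q ^+ 6) k * qpoch (q ^+ 6 * y) (q ^+ 6) k
     * qpoch (q ^+ 2) (q ^+ 2) (2 * k)).

(** This is the WZ relation of [qcert_diff] divided by the product common to its four terms, with X
    = q^(2k). *)
Lemma qcert_identity (F : fieldType) (q y X : F) :
  q != 0 -> y != 0 ->
  1 - q * y != 0 -> 1 - q ^+ 3 * y != 0 -> 1 - q ^+ 5 * y != 0 ->
  1 - y != 0 -> 1 - q ^+ 6 * X ^+ 3 * y != 0 ->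
  q ^+ 3 * (1 - y) *
  ((1 - q * y * X) * (1 - q ^+ 3 * y * X) * (1 - q ^+ 5 * y * X)
    / ((1 - q * y) * (1 - q ^+ 3 * y) * (1 - q ^+ 5 * y))
    * (1 - X ^+ 3 / y) / (1 - y^-1)
    * (1 - q ^+ 6 * y) / (1 - q ^+ 6 * X ^+ 3 * y) * (1 - q * X ^+ 4))
  - (1 - q ^+ 6 * y) *
  ((1 - q ^- 5 / y * X) * (1 - q ^- 3 / y * X) * (1 - q ^- 1 / y * X)
    / ((1 - q ^- 5 / y) * (1 - q ^- 3 / y) * (1 - q ^- 1 / y))
    * (1 - q * X ^+ 4))
  =
  (1 - q ^+ 6 * y ^+ 2) * (1 - q ^+ 6 * y) * q ^+ 3 * y
  / ((1 - q ^+ 5 * y) * (1 - q ^+ 3 * y) * (1 - q * y)) *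
  ((1 - q ^- 5 / y * X) * (1 - q * y * X)
     * (1 - q * X ^+ 2) * (1 - q ^+ 3 * X ^+ 2) * (q ^+ 2 * X ^+ 2)
     / (1 - q ^+ 6 * X ^+ 3 * y)
   - (1 - X ^+ 2) * (1 - X ^+ 2 / q ^+ 2) * (1 - X ^+ 3 / y)).
Proof.
move=> q0 y0 h1 h3 h5 hy hX.
field.
by rewrite -!(opprB 1) !oppr_eq0 y0 q0 hX h1 h3 h5 hy.
Qed.

Lemma qpoch_neq0 (F : fieldType) (x t : F) m :
  (forall i, (i < m)%N -> 1 - x * t ^+ i != 0) -> qpoch x t m != 0.
Proof. by move=> h; apply/prodf_neq0 => i _; apply: h. Qed.

Lemma double_sqrS k : (2 * k.+1 ^ 2 = 2 * k ^ 2 + (2 + 2 * k * 2))%N.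
Proof. by rewrite -(addn1 k) sqrnD; lia. Qed.

Lemma qcert_diff (F : fieldType) (q y : F) (k : nat) :
  q != 0 -> y != 0 ->
  1 - q * y != 0 -> 1 - q ^+ 3 * y != 0 -> 1 - q ^+ 5 * y != 0 ->
  (forall i, (0 < i)%N -> 1 - q ^+ i != 0) ->
  (forall i, 1 - q ^+ (6 * i) * y != 0) ->
  (forall i, 1 - q ^+ (6 * i) / y != 0) ->
  q ^+ 3 * (1 - y) * qterm q (q ^+ 6 * y) k - (1 - q ^+ 6 * y) * qterm q y k
  = qcert q y k.+1 - qcert q y k.
Proof.
move=> q0 y0 h1 h3 h5 hq hy hy'.
have [X X1] : exists X, q ^+ (2 * k) = X by eexists.
have XE j : q ^+ (2 * k * j) = X ^+ j by rewrite exprM X1.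
have X3 : q ^+ (6 * k) = X ^+ 3 by rewrite -XE mulnAC.
have X4 : q ^+ (8 * k + 1) = q * X ^+ 4 by rewrite exprD expr1 mulrC -XE mulnAC.
have X2 : q ^+ (4 * k) = X ^+ 2 by rewrite -XE mulnAC.
have h0 : 1 - y != 0 by have := hy 0%N; rewrite muln0 expr0 mul1r.
have h0' : 1 - y^-1 != 0 by have := hy' 0%N; rewrite muln0 expr0 mul1r.
have h6 : 1 - q ^+ 6 * y != 0 by have := hy 1%N.
have h6X : 1 - q ^+ 6 * X ^+ 3 * y != 0.
  by have := hy k.+1; rewrite mulnS exprD X3.
have h6X' : 1 - q ^+ 6 * X ^+ 3 / y != 0.
  by have := hy' k.+1; rewrite mulnS exprD X3.
(* All four terms are multiples of ABDE / (MNL) by rational functions of q, y and X. [A] starts at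
   q^-5 / y because y -> q^6 y turns q / y into this. *)
pose A := qpoch (q ^- 5 / y) (q ^+ 2) k; pose B := qpoch (q * y) (q ^+ 2) k.
pose D := qpoch q (q ^+ 2) (2 * k); pose E := q ^+ (2 * k ^ 2).
pose M := qpoch (q ^+ 6 / y) (q ^+ 6) k.
pose N := qpoch (q ^+ 6 * y) (q ^+ 6) k.
pose L := qpoch (q ^+ 2) (q ^+ 2) (2 * k).
have M0 : M != 0.
  apply: qpoch_neq0 => i _; rewrite mulrAC -exprM -exprD -mulnS; exact: hy'.
have N0 : N != 0.
  apply: qpoch_neq0 => i _; rewrite mulrAC -exprM -exprD -mulnS; exact: hy.
have L0 : L != 0 by apply: qpoch_neq0 => i _; rewrite -exprM -exprD; apply: hq.
have := qcert_identity q0 y0 h1 h3 h5 h0 h6X.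
set C := (X in _ = X * _ -> _) => hid.
have divE (a b c : F) : a != 0 -> a * b = c -> b = c / a.
  by move=> a0 <-; rewrite mulrC mulKf.
have e2k : (2 * k.+1)%N = (2 * k).+2 by rewrite mulnS.
have p1' : (q ^+ 2) ^+ (2 * k) = X ^+ 2 by rewrite -XE -exprM mulnC.
have D2 : qpoch q (q ^+ 2) (2 * k.+1)
    = D * (1 - q * X ^+ 2) * (1 - q ^+ 3 * X ^+ 2).
  have p1 : q * (q ^+ 2) ^+ (2 * k) = q * X ^+ 2.
    by rewrite p1'.
  have p2 : q * (q ^+ 2) ^+ (2 * k).+1 = q ^+ 3 * X ^+ 2.
    by rewrite exprS mulrA p1' -exprS.
  by rewrite e2k !qpochS p1 p2.
have L2 : qpoch (q ^+ 2) (q ^+ 2) (2 * k.+1)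
    = L * (1 - q ^+ 2 * X ^+ 2) * (1 - q ^+ 4 * X ^+ 2).
  have p2 : q ^+ 2 * (q ^+ 2) ^+ (2 * k).+1 = q ^+ 4 * X ^+ 2.
    by rewrite (exprS _ (2 * k)) mulrA p1' -exprD.
  by rewrite e2k !qpochS p1' p2.
have l2 : 1 - q ^+ 2 * X ^+ 2 != 0 by rewrite -XE -exprD hq.
have l4 : 1 - q ^+ 4 * X ^+ 2 != 0 by rewrite -XE -exprD hq.
have e1 : qterm q (q ^+ 6 * y) k = A * B * D * E / (M * N * L)
    * ((1 - q * y * X) * (1 - q ^+ 3 * y * X) * (1 - q ^+ 5 * y * X)
    / ((1 - q * y) * (1 - q ^+ 3 * y) * (1 - q ^+ 5 * y))
    * (1 - X ^+ 3 / y) / (1 - y^-1)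
    * (1 - q ^+ 6 * y) / (1 - q ^+ 6 * X ^+ 3 * y) * (1 - q * X ^+ 4)).
  rewrite /qterm (_ : q / (q ^+ 6 * y) = q ^- 5 / y); last by field; rewrite q0 y0.
  rewrite (_ : q ^+ 6 / (q ^+ 6 * y) = y^-1); last by field; rewrite q0 y0.
  rewrite X4 -/A -/D -/E -/L.
  have -> : qpoch (q * (q ^+ 6 * y)) (q ^+ 2) k
     = B * (1 - q * y * X) * (1 - q ^+ 3 * y * X) * (1 - q ^+ 5 * y * X)
       / ((1 - q * y) * (1 - q ^+ 3 * y) * (1 - q ^+ 5 * y)).
    apply: divE; first by rewrite !mulf_neq0.
    have := qpoch_shift3 (q * y) (q ^+ 2) k; rewrite -!exprM X1 -/B.
    rewrite (_ : q * y * q ^+ (2 * 3) = q * (q ^+ 6 * y)); last by ring.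
    rewrite (_ : q * y * q ^+ 2 = q ^+ 3 * y); last by ring.
    by rewrite (_ : q * y * q ^+ (2 * 2) = q ^+ 5 * y); last by ring.
  have m0 : 1 - X ^+ 3 / y != 0 by rewrite -X3.
  have -> : qpoch (y^-1) (q ^+ 6) k = (1 - y^-1) * M / (1 - X ^+ 3 / y).
    apply: divE => //.
    by rewrite mulrC -X3 exprM (mulrC _ y^-1) -qpoch_shift (mulrC y^-1).
  have -> : qpoch (q ^+ 6 * (q ^+ 6 * y)) (q ^+ 6) k
      = N * (1 - q ^+ 6 * X ^+ 3 * y) / (1 - q ^+ 6 * y).
    apply: divE => //.
    by rewrite (mulrC _ (q ^+ 6 * y)) qpoch_shift -exprM X3 [q ^+ 6 * X ^+ 3 * y]mulrAC.
  by rewrite !invfM !invrK; ring.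
have e2 : qterm q y k = A * B * D * E / (M * N * L)
    * ((1 - q ^- 5 / y * X) * (1 - q ^- 3 / y * X) * (1 - q ^- 1 / y * X)
    / ((1 - q ^- 5 / y) * (1 - q ^- 3 / y) * (1 - q ^- 1 / y))
    * (1 - q * X ^+ 4)).
  have n1 : 1 - q ^- 1 / y != 0.
    rewrite (_ : _ - _ = - (1 - q * y) / (q * y)); last by field; rewrite q0 y0.
    by rewrite !mulf_neq0 // ?oppr_eq0 ?invr_eq0 // mulf_neq0.
  have n3 : 1 - q ^- 3 / y != 0.
    rewrite (_ : _ - _ = - (1 - q ^+ 3 * y) / (q ^+ 3 * y)); last by field; rewrite q0 y0.
    by rewrite !mulf_neq0 // ?oppr_eq0 ?invr_eq0 // !mulf_neq0 // expf_neq0.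
  have n5 : 1 - q ^- 5 / y != 0.
    rewrite (_ : _ - _ = - (1 - q ^+ 5 * y) / (q ^+ 5 * y)); last by field; rewrite q0 y0.
    by rewrite !mulf_neq0 // ?oppr_eq0 ?invr_eq0 // !mulf_neq0 // expf_neq0.
  rewrite /qterm X4 -/B -/D -/E -/M -/N -/L.
  have -> : qpoch (q / y) (q ^+ 2) k
     = A * (1 - q ^- 5 / y * X) * (1 - q ^- 3 / y * X) * (1 - q ^- 1 / y * X)
       / ((1 - q ^- 5 / y) * (1 - q ^- 3 / y) * (1 - q ^- 1 / y)).
    apply: divE; first by rewrite !mulf_neq0.
    have := qpoch_shift3 (q ^- 5 / y) (q ^+ 2) k; rewrite -!exprM X1 -/A.
    rewrite (_ : q ^- 5 / y * q ^+ (2 * 3) = q / y); last by field; rewrite q0 y0.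
    rewrite (_ : q ^- 5 / y * q ^+ 2 = q ^- 3 / y); last by field; rewrite q0 y0.
    by rewrite (_ : q ^- 5 / y * q ^+ (2 * 2) = q ^- 1 / y); last by field; rewrite q0 y0.
  by ring.
have e3 : qcert q y k = A * B * D * E / (M * N * L)
    * (C * ((1 - X ^+ 2) * (1 - X ^+ 2 / q ^+ 2) * (1 - X ^+ 3 / y))).
  by rewrite /qcert -/A -/B -/D -/E -/M -/N -/L -/C X2 X3; ring.
have e4 : qcert q y k.+1 = A * B * D * E / (M * N * L)
    * (C * ((1 - q ^- 5 / y * X) * (1 - q * y * X)
     * (1 - q * X ^+ 2) * (1 - q ^+ 3 * X ^+ 2) * (q ^+ 2 * X ^+ 2)
     / (1 - q ^+ 6 * X ^+ 3 * y))).
  rewrite /qcert -/C D2 L2 !qpochS -/A -/B -/M -/N -!exprM X1 X3.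
  rewrite (_ : q ^+ (2 * k.+1 ^ 2) = E * (q ^+ 2 * X ^+ 2)); last first.
    by rewrite double_sqrS exprD (exprD _ 2) XE.
  rewrite (_ : q ^+ (4 * k.+1) = q ^+ 4 * X ^+ 2); last by rewrite mulnS exprD X2.
  rewrite (_ : q ^+ (6 * k.+1) = q ^+ 6 * X ^+ 3); last by rewrite mulnS exprD X3.
  have -> : q ^+ 4 * X ^+ 2 / q ^+ 2 = q ^+ 2 * X ^+ 2 by field.
  have -> : q ^+ 6 / y * X ^+ 3 = q ^+ 6 * X ^+ 3 / y by ring.
  have -> : q ^+ 6 * y * X ^+ 3 = q ^+ 6 * X ^+ 3 * y by ring.
  (* The factors [a], [b], [c] of [qcert] at k + 1 cancel the newest factors of [L] and [M]. *)
  have key (a b c d e f g h i z : F) : a != 0 -> b != 0 -> c != 0 -> d != 0 ->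
      z * (A * g) * (B * h) * (D * e * f) * (E * i) * a * b * c
      / (M * c * (N * d) * (L * b * a))
      = A * B * D * E / (M * N * L) * (z * (g * h * e * f * i / d)).
    by move=> a0 b0 c0 d0; field; rewrite a0 b0 c0 d0 M0 N0 L0.
  exact: key.
have fin (a b c d s t x z : F) : a * s - b * t = x * (c - d) ->
    a * (z * s) - b * (z * t) = z * (x * c) - z * (x * d).
  by move=> h; rewrite -!mulrBr -h; ring.
by rewrite e1 e2 e3 e4; apply: fin.
Qed.

(** The differences of [qcert] telescope; [qcert] vanishes at 0 through the factor 1 - q^(4k), and
    at K by the last hypothesis. *)
Lemma sum_qterm_rec (F : fieldType) (q y : F) (K : nat) :
  q != 0 -> y != 0 ->
  1 - q * y != 0 -> 1 - q ^+ 3 * y != 0 -> 1 - q ^+ 5 * y != 0 ->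
  (forall i, (0 < i)%N -> 1 - q ^+ i != 0) ->
  (forall i, 1 - q ^+ (6 * i) * y != 0) ->
  (forall i, 1 - q ^+ (6 * i) / y != 0) ->
  qpoch (q ^- 5 / y) (q ^+ 2) K = 0 ->
  q ^+ 3 * (1 - y) * (\sum_(k < K) qterm q (q ^+ 6 * y) k)
  = (1 - q ^+ 6 * y) * \sum_(k < K) qterm q y k.
Proof.
move=> q0 y0 h1 h3 h5 hq hy hy' hK; apply/eqP; rewrite -subr_eq0; apply/eqP.
rewrite 2!mulr_sumr -sumrB.
rewrite (eq_bigr (fun k : 'I_K => qcert q y k.+1 - qcert q y k)); last first.
  by move=> k _; apply: qcert_diff.
rewrite -(big_mkord xpredT (fun k => qcert q y k.+1 - qcert q y k)).
rewrite telescope_sumr // /qcert hK !muln0 expr0 subrr !(mulr0, mul0r).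
by rewrite subrr.
Qed.

Lemma qterm_eq0 (F : fieldType) (q : F) (n k : nat) :
  q != 0 -> odd n -> (n < 2 * k)%N -> qterm q (q ^+ n) k = 0.
Proof.
move=> q0 on nk; rewrite /qterm.
suff -> : qpoch (q / q ^+ n) (q ^+ 2) k = 0 by rewrite !mul0r.
(* As n is odd, the factor of index (n-1)/2 is 1 - q^(1-n) q^(n-1) = 0. *)
have hk : (n./2 < k)%N by lia.
rewrite /qpoch (bigD1 (Ordinal hk)) //= -exprM.
rewrite (_ : 2 * n./2 = n.-1)%N; last by lia.
case: n on nk hk => // n on nk hk.
by rewrite mulrAC -exprS divff ?expf_neq0 // subrr mul0r.
Qed.

Lemma sum_qterm_widen (F : fieldType) (q : F) (n m K : nat) :
  q != 0 -> odd n -> (n < 2 * m)%N -> (m <= K)%N ->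
  \sum_(k < K) qterm q (q ^+ n) k = \sum_(k < m) qterm q (q ^+ n) k.
Proof.
move=> q0 on nm mK; rewrite (big_ord_widen _ (qterm q (q ^+ n)) mK).
rewrite [LHS](bigID (fun k : 'I_K => k < m)%N) /= [X in _ + X]big1 ?addr0 // => k.
by rewrite -leqNgt => mk; apply: qterm_eq0 => //; lia.
Qed.

Lemma sum_qterm1 (F : fieldType) (q : F) (K : nat) :
  q != 0 -> (1 < 2 * K)%N -> \sum_(k < K) qterm q (q ^+ 1) k = 1 - q.
Proof.
move=> q0 hK; rewrite (@sum_qterm_widen _ _ _ 1) //; last by lia.
by rewrite big_ord1 /qterm !muln0 !qpoch0 expr0 !(mulr1, invr1, mul1r).
Qed.

(** Only k = 0, 1, 2 contribute, so this starting value for the class of 5 modulo 6 is a finite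
    computation. *)
Lemma sum_qterm5 (F : fieldType) (q : F) (K : nat) :
  (forall i, (0 < i)%N -> 1 - q ^+ i != 0) ->
  q != 0 -> (5 < 2 * K)%N ->
  q ^+ 2 * (\sum_(k < K) qterm q (q ^+ 5) k) = - (1 - q ^+ 5).
Proof.
move=> hq q0 hK; rewrite (@sum_qterm_widen _ _ _ 3) //; last by lia.
rewrite !big_ord_recr big_ord0 /= /qterm /= !muln0 !qpoch0
  !(mulr1, invr1, mul1r, add0r, add0n, expr0).
rewrite !muln1 /qpoch !(big_ord_recr, big_ord0) /= -!exprM -!exprD !mul1r.
have -> : q / q ^+ 5 * q ^+ (2 * 0) = q ^- 4 by field.
have -> : q / q ^+ 5 * q ^+ (2 * 1) = q ^- 2 by field.
have -> : q ^+ 6 / q ^+ 5 * q ^+ (6 * 0) = q by field.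
have -> : q ^+ 6 / q ^+ 5 * q ^+ (6 * 1) = q ^+ 7 by field.
rewrite -!exprS -!exprD; have h1 := hq 1 isT; have h2 := hq 2 isT; have h4 := hq 4 isT.
have h6 := hq 6 isT; have h7 := hq 7 isT; have h8 := hq 8 isT.
have h11 := hq 11 isT; have h17 := hq 17 isT.
by field; rewrite h8 h6 h4 h2 h17 h11 h7 h1 q0.
Qed.

(** Induction with step 6 from n = 1 and n = 5, whose signs are + and -; the step keeps the sign.
    The sign may stay unspecified because the sum is squared in the end. *)
Lemma sum_qterm (F : fieldType) (q : F) (n K : nat) :
  (forall i, (0 < i)%N -> 1 - q ^+ i != 0) -> q != 0 ->
  coprime n 6 -> (n < 2 * K)%N ->
  exists s : bool,
    q ^+ n./2 * \sum_(k < K) qterm q (q ^+ n) k = (-1) ^+ s * (1 - q ^+ n).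
Proof.
move=> hq q0.
have step m (s : bool) : coprime m 6 ->
  (forall K, (m < 2 * K)%N ->
    q ^+ m./2 * \sum_(k < K) qterm q (q ^+ m) k = (-1) ^+ s * (1 - q ^+ m)) ->
  (forall K, (m + 6 < 2 * K)%N ->
    q ^+ (m + 6)./2 * \sum_(k < K) qterm q (q ^+ (m + 6)) k
    = (-1) ^+ s * (1 - q ^+ (m + 6))).
  move=> cm hm {}K hK.
  have m0 : (0 < m)%N by case: m cm {hm hK}.
  have om : odd m by move: cm; rewrite (coprimeMr _ 2 3) coprimen2 => /andP[].
  have m3 : ~~ (3 %| m)%N.
    by move: cm; rewrite (coprimeMr _ 2 3) (coprime_sym m 3)
      (@prime_coprime 3 m isT) => /andP[].
  have rec : q ^+ 3 * (1 - q ^+ m) * (\sum_(k < K) qterm q (q ^+ 6 * q ^+ m) k)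
     = (1 - q ^+ 6 * q ^+ m) * \sum_(k < K) qterm q (q ^+ m) k.
    apply: sum_qterm_rec; rewrite ?expf_neq0 //.
    - by rewrite -exprS hq.
    - by rewrite -exprD hq.
    - by rewrite -exprD hq.
    - by move=> i; rewrite -exprD hq // addn_gt0 m0 orbT.
    (* The factor vanishes only for m = 6i, which is impossible as 3 does not divide m. *)
    - move=> i; case: (ltngtP m (6 * i)) => [lt|gt|e].
      + by rewrite -expfB // hq // subn_gt0.
      + rewrite -(subnK (ltnW gt)) exprD invfM mulrCA divff ?expf_neq0 // mulr1.
        by rewrite -(mulVf (expf_neq0 (m - 6 * i) q0)) -[X in _ - X]mulr1 -mulrBr
          mulf_neq0 ?invr_eq0 ?expf_neq0 // -opprB oppr_eq0 hq // subn_gt0.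
      + by move: m3; rewrite e (dvdn_mulr _ (isT : (3 %| 6)%N)).
    (* Termination: the factor of index (m+5)/2 is 1 - q^(-5-m) q^(m+5) = 0. *)
    rewrite /qpoch; have hk : ((m + 5)./2 < K)%N by lia.
    rewrite (bigD1 (Ordinal hk)) //= -exprM -invfM -exprD.
    rewrite (_ : 2 * (m + 5)./2 = 5 + m)%N; last by lia.
    by rewrite mulVf ?expf_neq0 // subrr mul0r.
  have hmK : (m < 2 * K)%N by lia.
  apply: (mulfI (hq _ m0)).
  rewrite (_ : (m + 6)./2 = m./2 + 3)%N; last by lia.
  rewrite (addnC m) (exprD _ m./2) (exprD _ 6).
  transitivity (q ^+ m./2 * (q ^+ 3 * (1 - q ^+ m)
     * (\sum_(k < K) qterm q (q ^+ 6 * q ^+ m) k))); first by ring.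
  by rewrite rec mulrCA hm //; ring.
have base1 K' : (1 < 2 * K')%N ->
  q ^+ 1./2 * \sum_(k < K') qterm q (q ^+ 1) k = (-1) ^+ false * (1 - q ^+ 1).
  by move=> hK; rewrite sum_qterm1 // !mul1r expr1.
have base5 K' : (5 < 2 * K')%N ->
  q ^+ 5./2 * \sum_(k < K') qterm q (q ^+ 5) k = (-1) ^+ true * (1 - q ^+ 5).
  by move=> hK; rewrite sum_qterm5 // expr1 mulN1r.
move=> cn; suff [s hs] : exists s : bool, forall K, (n < 2 * K)%N ->
    q ^+ n./2 * \sum_(k < K) qterm q (q ^+ n) k = (-1) ^+ s * (1 - q ^+ n).
  by move=> hK; exists s; apply: hs.
elim/ltn_ind: n cn => n IH cn.
case: (ltnP n 6) => [n6|n6].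
  case: n n6 cn {IH} => [|[|[|[|[|[|n]]]]]] //= _ _.
    by exists false.
  by exists true.
have cn' : coprime (n - 6) 6.
  by move: cn; rewrite -{1}(subnK n6) coprime_sym /coprime gcdnDr gcdnC.
have lt : (n - 6 < n)%N by lia.
have [s hs] := IH _ lt cn'; exists s; rewrite -(subnK n6); exact: step.
Qed.

(** * Localization of Z[q] at a cyclotomic polynomial *)

Section Localization.

Variables (d : nat) (z : algC).
Hypothesis z_prim : d.-primitive_root z.

Lemma prim_root_neq0 : z != 0.
Proof.
apply: contra_eq_neq (prim_expr_order z_prim) => ->.
by rewrite expr0n gtn_eqF ?(prim_order_gt0 z_prim) // eq_sym oner_neq0.
Qed.

Definition evz (A : {poly int}) : algC := (map_poly intr A).[z].

Lemma evzM A B : evz (A * B) = evz A * evz B.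
Proof. by rewrite /evz rmorphM hornerM. Qed.

Lemma evz_subXn m : evz (1 - 'X^m) = 1 - z ^+ m.
Proof. by rewrite /evz rmorphB rmorph1 /= map_polyXn !hornerE. Qed.

Lemma evz_Cyclotomic : evz 'Phi_d = 0.
Proof.
by apply/rootP; rewrite (Cintr_Cyclotomic z_prim) root_cyclotomic.
Qed.

(** Phi_d is the minimal polynomial of z over Q; since it is monic, the quotient in Q[q] already
    lies in Z[q]. *)
Lemma evz_eq0 A : evz A = 0 -> zdvdp 'Phi_d A.
Proof.
move=> A0; have [p [pE _] pP] := minCpolyP z.
have pPhi : p = map_poly intr 'Phi_d.
  apply: (@map_poly_inj _ _ (ratr : {rmorphism rat -> algC})).
  rewrite /= -pE (minCpoly_cyclotomic z_prim) -(Cintr_Cyclotomic z_prim).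
  by rewrite -map_poly_comp; apply: eq_map_poly => a /=; rewrite ratr_int.
have : p %| map_poly intr A.
  rewrite -pP -map_poly_comp; apply/rootP; rewrite -[RHS]A0 /evz.
  by congr (_.[z]); apply: eq_map_poly => a /=; rewrite ratr_int.
rewrite pPhi dvdp_rat_int => /(Pdiv.IdomainMonic.dvdpP (Cyclotomic_monic d)) [B ->].
by exists B; rewrite mulrC.
Qed.

(* [loc e] is the e-th power of the maximal ideal of the local ring of Z[q] at
   (Phi_d); a denominator is prime to Phi_d iff it does not vanish at z. *)
Definition loc (e : nat) (x : ratfun) : Prop :=
  exists A B : {poly int}, x = ('Phi_d ^+ e * A)%:F / B%:F /\ evz B != 0.

Lemma evz_neq0 A : evz A != 0 -> A%:F != 0 :> ratfun.
Proof.
by rewrite tofrac_eq0; apply: contraNneq => ->; rewrite /evz rmorph0 horner0.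
Qed.

Lemma loc_0 e : loc e 0.
Proof.
by exists 0, 1; rewrite mulr0 tofrac0 mul0r /evz rmorph1 hornerE oner_neq0.
Qed.

Lemma loc_poly A : loc 0 A%:F.
Proof.
by exists A, 1; rewrite mul1r tofrac1 divr1 /evz rmorph1 hornerE oner_neq0.
Qed.

Lemma loc_1 : loc 0 1.
Proof. by have := loc_poly 1; rewrite tofrac1. Qed.

Lemma loc_qX i : loc 0 (q ^+ i).
Proof. by rewrite /q -tofracXn; apply: loc_poly. Qed.

Lemma locM e f x y : loc e x -> loc f y -> loc (e + f) (x * y).
Proof.
move=> [A [B [-> B0]]] [A' [B' [-> B'0]]]; exists (A * A'), (B * B'); split.
  by rewrite mulf_div -!tofracM exprD mulrACA.
by rewrite evzM mulf_neq0.
Qed.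

Lemma locMl e x y : loc 0 x -> loc e y -> loc e (x * y).
Proof. exact: locM. Qed.

Lemma locMr e x y : loc e x -> loc 0 y -> loc e (x * y).
Proof. by rewrite -{2}(addn0 e); exact: locM. Qed.

Lemma locD e x y : loc e x -> loc e y -> loc e (x + y).
Proof.
move=> [A [B [-> B0]]] [A' [B' [-> B'0]]]; exists (A * B' + A' * B), (B * B').
split; last by rewrite evzM mulf_neq0.
by rewrite addf_div ?evz_neq0 // -!tofracM -tofracD mulrDr !mulrA.
Qed.

Lemma locN e x : loc e x -> loc e (- x).
Proof.
by move=> [A [B [-> B0]]]; exists (- A), B; rewrite mulrN tofracN mulNr.
Qed.

Lemma locB e x y : loc e x -> loc e y -> loc e (x - y).
Proof. by move=> hx hy; apply: locD => //; apply: locN. Qed.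

Lemma loc_sub e x y : loc e (x - y) -> loc e y -> loc e x.
Proof. by move=> h /(locD h); rewrite subrK. Qed.

Lemma loc_leq e f x : (f <= e)%N -> loc e x -> loc f x.
Proof.
move=> fe [A [B [-> B0]]]; exists ('Phi_d ^+ (e - f) * A), B; split => //.
by rewrite mulrA -exprD subnKC.
Qed.

Lemma locX e x m : loc e x -> loc (m * e) (x ^+ m).
Proof.
move=> h; elim: m => [|m IH]; first by rewrite expr0; apply: loc_1.
by rewrite exprS mulSn; apply: locM.
Qed.

Lemma loc_sum e I (r : seq I) (P : pred I) (F : I -> ratfun) :
  (forall i, P i -> loc e (F i)) -> loc e (\sum_(i <- r | P i) F i).
Proof.
by move=> h; elim/big_ind: _ => //; [apply: loc_0 | apply: locD].
Qed.

Lemma subXnE m : 1 - q ^+ m = (1 - 'X^m)%:F.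
Proof. by rewrite tofracB tofrac1 tofracXn. Qed.

Lemma loc_subXn m : loc 0 (1 - q ^+ m).
Proof. by rewrite subXnE; apply: loc_poly. Qed.

Lemma loc_subXn_dvd m : (d %| m)%N -> loc 1 (1 - q ^+ m).
Proof.
move=> dm; have [|B hB] := @evz_eq0 (1 - 'X^m).
  by rewrite evz_subXn; apply/eqP; rewrite subr_eq0 eq_sym -(prim_order_dvd z_prim).
rewrite subXnE hB; exists B, 1.
by rewrite expr1 tofrac1 divr1 /evz rmorph1 hornerE oner_neq0.
Qed.

Lemma loc_subXnV m : ~~ (d %| m)%N -> loc 0 (1 - q ^+ m)^-1.
Proof.
move=> dm; exists 1, (1 - 'X^m); rewrite mulr1 tofrac1 mul1r -subXnE; split=> //.
by rewrite evz_subXn subr_eq0 eq_sym -(prim_order_dvd z_prim).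
Qed.

Lemma loc_qXV i : loc 0 (q ^- i).
Proof.
exists 1, 'X^i; rewrite mulr1 tofrac1 mul1r tofracXn; split=> //.
rewrite /evz map_polyXn hornerXn expf_neq0 //.
exact: prim_root_neq0.
Qed.

(* Phi_d is a simple factor of 1 - X^m because the derivative of X^m does not
   vanish at z. *)
Lemma loc_div_subXn e m x :
  (d %| m)%N -> (0 < m)%N -> loc e.+1 x -> loc e (x / (1 - q ^+ m)).
Proof.
move=> dm m0 [A [B [-> B0]]].
have z0 := prim_root_neq0.
have [|E hE] := @evz_eq0 (1 - 'X^m).
  by rewrite evz_subXn; apply/eqP; rewrite subr_eq0 eq_sym -(prim_order_dvd z_prim).
have E0 : evz E != 0.
  apply/eqP => E0; have := congr1 (fun P => evz P^`()) hE.
  rewrite derivM derivB derivXn derivC sub0r.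
  rewrite /evz rmorphN rmorphD !rmorphM /= !hornerE.
  rewrite -[(map_poly intr E).[z]]/(evz E) -[(map_poly intr 'Phi_d).[z]]/(evz _).
  rewrite E0 evz_Cyclotomic mulr0 mul0r addr0 => /eqP.
  rewrite rmorphMn /= map_polyXn hornerMn hornerXn oppr_eq0 mulrn_eq0.
  by rewrite -leqn0 leqNgt m0 expf_eq0 (negPf z0) andbF.
exists A, (B * E); split; last by rewrite evzM mulf_neq0.
have P0 : ('Phi_d : {poly int})%:F != 0 :> ratfun.
  by rewrite tofrac_eq0 monic_neq0 ?Cyclotomic_monic.
rewrite subXnE hE exprS !tofracM; move/evz_neq0: B0; move/evz_neq0: E0 => E0 B0.
have key (F : fieldType) (p u a b c : F) : p != 0 -> b != 0 -> c != 0 ->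
    p * u * a / b / (p * c) = u * a / (b * c).
  by move=> p0 b0 c0; field; rewrite c0 b0 p0.
by move: (key _ _ (('Phi_d ^+ e)%:F) A%:F _ _ P0 B0 E0) => ->.
Qed.

Lemma loc_qX_cong i t : loc 1 (q ^+ (i + d * t) - q ^+ i).
Proof.
rewrite -opprB exprD -[X in X - _]mulr1 -mulrBr -mulrN; apply: locMl.
  exact: loc_qX.
by apply: locN; apply: loc_subXn_dvd; apply: dvdn_mulr.
Qed.

End Localization.

(** * Exponents and congruences of the summands *)

(** One factor of (q;q^2)_k / (q^s;q^s)_k, used for s = 6 and s = 2. Pairing numerator and
    denominator lets the exponent of Phi_d be followed factor by factor. *)
Definition vfactor (s k : nat) : ratfun := (1 - q ^+ (2 * k + 1)) / (1 - q ^+ (s * k.+1)).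

Definition vprod (s k : nat) : ratfun := \prod_(i < k) vfactor s i.

(* The factor of [c_q k] other than [8k+1] q^(2k^2). *)
Definition bq (k : nat) : ratfun := vprod 6 k ^+ 2 * vprod 2 (2 * k).

Lemma subqX_neq0 m : (0 < m)%N -> 1 - q ^+ m != 0.
Proof.
move=> m0; rewrite subXnE tofrac_eq0 -opprB oppr_eq0 monic_neq0 //.
by rewrite monicXnsubC.
Qed.

Lemma vprodS s k : vprod s k.+1 = vprod s k * vfactor s k.
Proof. exact: big_ord_recr. Qed.

Lemma vprod0 s : vprod s 0 = 1.
Proof. exact: big_ord0. Qed.

Lemma modnS_dvd d k : (0 < d)%N -> (d %| k.+1)%N ->
  (k %% d)%N = d.-1 /\ (k.+1 %% d)%N = 0%N.
Proof.
move=> d0 dk; move: (dk); rewrite /dvdn => /eqP k0; split=> //.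
move: k0; rewrite -addn1 -modnDml => /eqP; rewrite -/(dvdn _ _) => h.
have := ltn_pmod k d0; have := dvdn_leq _ h; lia.
Qed.

Lemma modnS_ndvd d k : (0 < d)%N -> ~~ (d %| k.+1)%N -> (k.+1 %% d)%N = (k %% d).+1.
Proof.
move=> d0 dk; rewrite -addn1 -modnDml addn1 modn_small //.
rewrite ltn_neqAle (ltn_pmod k d0) andbT; apply: contra dk => /eqP h.
by rewrite /dvdn -addn1 -modnDml addn1 h modnn.
Qed.

(* A lower bound for the exponent of Phi_d in [bq k] when r = k mod d.  For k < d
   the jumps come from 1 - q^d in (q;q^2)_(2k); from 1 - q^d, squared, in
   (q;q^2)_k^2 against 1 - q^(2d) in (q^2;q^2)_(2k); and from 1 - q^(3d). *)
Definition wt (d r : nat) : nat := (d < 4 * r) + (d < 2 * r) + (3 * d < 4 * r).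

(** The right side is the exponent obtained from the two products in [bq]. If 2r < d then 2r mod d =
    2r; if 2r > d it is 2r - d, and d < 2(2r - d) means 3d < 4r. *)
Lemma wt_double d r : odd d -> (r < d)%N ->
  (wt d r <= 2 * (d < 2 * r) + (d < 2 * ((2 * r) %% d)))%N.
Proof.
move=> od rd; rewrite /wt.
case: (ltnP (2 * r) d) => h.
  rewrite modn_small //; lia.
rewrite -[X in (X %% d)%N](subnK h) modnDr modn_small; lia.
Qed.

Section Summands.

Variables (d : nat) (z : algC).
Hypothesis z_prim : d.-primitive_root z.
Hypotheses (d_gt1 : (1 < d)%N) (co_d6 : coprime d 6).

Local Notation loc := (loc d z).

Lemma d_odd : odd d.
Proof. by move: co_d6; rewrite (coprimeMr _ 2 3) coprimen2 => /andP[]. Qed.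

Lemma d_gt4 : (4 < d)%N.
Proof. by case: d d_gt1 co_d6 => [|[|[|[|[|]]]]]. Qed.

Let d_gt0 : (0 < d)%N := ltnW d_gt1.

Lemma dvd_scale s m : coprime d s -> (d %| s * m)%N = (d %| m)%N.
Proof. exact: Gauss_dvdr. Qed.

Lemma loc_vfactor_den s k : coprime d s -> ~~ (d %| k.+1)%N ->
  loc 0 (1 - q ^+ (s * k.+1))^-1.
Proof. by move=> ds dk; apply: loc_subXnV => //; rewrite dvd_scale. Qed.

Lemma loc_vfactor s k : coprime d s -> ~~ (d %| k.+1)%N -> loc 0 (vfactor s k).
Proof. by move=> ds dk; apply: locMl; [apply: loc_subXn | apply: loc_vfactor_den]. Qed.

(** In each period the numerator gains a Phi_d at index (d-1)/2 and the denominator takes one at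
    index d-1, so the exponent is at least 1 between these two events and at least 0 elsewhere. *)
Lemma loc_vprod s k : coprime d s -> (0 < s)%N -> loc (d < 2 * (k %% d)) (vprod s k).
Proof.
move=> ds s0; elim: k => [|k IH].
  by rewrite vprod0 mod0n muln0 ltn0; apply: loc_1.
rewrite vprodS; have [dk|dk] := boolP (d %| k.+1)%N.
  (* Here k mod d = d - 1, so the exponent 1 available so far pays for the division. *)
  have [k1 k0] := modnS_dvd d_gt0 dk; move: IH; rewrite k1 k0 muln0 ltn0.
  have -> : (d < 2 * d.-1)%N = true by move: d_gt4; lia.
  move=> IH; rewrite mulrA; apply: loc_div_subXn => //.
  - by rewrite dvd_scale.
  - by rewrite muln_gt0 s0.
  - by apply: locMr => //; apply: loc_subXn.
rewrite (modnS_ndvd d_gt0 dk); have [dk2|dk2] := boolP (d %| 2 * k + 1)%N.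
  apply: (@loc_leq _ _ (0 + 1)); first by case: (_ < _)%N.
  apply: locM; first by apply: loc_leq IH.
  by apply: locMr; [apply: loc_subXn_dvd | apply: loc_vfactor_den].
have -> : (d < 2 * (k %% d).+1)%N = (d < 2 * (k %% d))%N.
  (* The comparison of d with 2(k mod d) changes only on passing (d-1)/2, that is when d divides 2k
     + 1. *)
  have ne : d != (2 * (k %% d) + 1)%N.
    apply: contra dk2 => /eqP e; rewrite /dvdn -modnDml -modnMmr modnDml.
    by rewrite -e modnn.
  by move: d_odd ne; lia.
by apply: locMr => //; apply: loc_vfactor.
Qed.

(** Modulo Phi_d, q^d = 1, so numerator and denominator depend on r only; the denominators are
    invertible because 0 < r + 1 < d. *)
Lemma loc_vfactor_cong s u r : coprime d s -> (0 < s)%N -> (r.+1 < d)%N ->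
  loc 1 (vfactor s (d * u + r) - vfactor s r).
Proof.
move=> ds s0 rd; have nd : ~~ (d %| r.+1)%N by rewrite gtnNdvd.
have nd' : ~~ (d %| (d * u + r).+1)%N by rewrite -addnS dvdn_addr ?dvdn_mulr.
have key (F : fieldType) (a b a' b' : F) : b != 0 -> b' != 0 ->
    a / b - a' / b' = ((a - a') * b' - a' * (b - b')) * b^-1 * b'^-1.
  by move=> b0 b'0; field; rewrite b0 b'0.
rewrite /vfactor key; last 2 first.
- by apply: subqX_neq0; rewrite muln_gt0 s0.
- by apply: subqX_neq0; rewrite muln_gt0 s0.
do 2 (apply: locMr; last by apply: loc_vfactor_den).
have c m n : loc 1 ((1 - q ^+ (m + d * n)) - (1 - q ^+ m)).
  have e (F : fieldType) (x y : F) : (1 - x) - (1 - y) = - (x - y) by ring.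
  by rewrite e; apply: locN; apply: loc_qX_cong.
apply: locB.
  apply: locMr; last exact: loc_subXn.
  rewrite (_ : 2 * (d * u + r) + 1 = 2 * r + 1 + d * (2 * u))%N; first exact: c.
  lia.
apply: locMl; first exact: loc_subXn.
rewrite (_ : s * (d * u + r).+1 = s * r.+1 + d * (s * u))%N; first exact: c.
lia.
Qed.

Lemma loc_vprod_cong s u r : coprime d s -> (0 < s)%N -> (r < d)%N ->
  loc 1 (vprod s (d * u + r) - vprod s (d * u) * vprod s r).
Proof.
move=> ds s0; elim: r => [|r IH] rd.
  by rewrite vprod0 mulr1 addn0 subrr; apply: loc_0.
have nd : ~~ (d %| r.+1)%N by rewrite gtnNdvd.
have nd' : ~~ (d %| (d * u + r).+1)%N by rewrite -addnS dvdn_addr ?dvdn_mulr.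
have key (F : fieldType) (a b c f g : F) :
    a * f - b * (c * g) = (a - b * c) * f + b * c * (f - g) by ring.
have lv k : loc 0 (vprod s k) by apply: loc_leq (loc_vprod _ _ _).
rewrite addnS !vprodS key; apply: locD.
  by apply: locMr; [apply: IH; apply: ltnW | apply: loc_vfactor].
by apply: locMl; [apply: locMl | apply: loc_vfactor_cong].
Qed.

Lemma co_d2 : coprime d 2.
Proof. by move: co_d6; rewrite (coprimeMr _ 2 3) => /andP[]. Qed.

Lemma loc_bq k : loc (wt d (k %% d)) (bq k).
Proof.
apply: loc_leq (wt_double d_odd (ltn_pmod k d_gt0)) _.
rewrite modnMmr; apply: locM; last by apply: loc_vprod => //; apply: co_d2.
by apply: locX; apply: loc_vprod.
Qed.

(** If 2r > d, both terms are divisible by Phi_d. If 2r < d, then 2r is still a residue, and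
    [loc_vprod_cong] applies to all the products, with 2u and 2r in the last one. *)
Lemma loc_bq_cong u r : (r < d)%N -> loc 1 (bq (d * u + r) - bq (d * u) * bq r).
Proof.
move=> rd; have [h|h] := ltnP (2 * r) d; last first.
  have l t : loc 1 (bq (d * t + r)).
    apply: loc_leq (loc_bq _); rewrite mulnC modnMDl modn_small // /wt.
    by move: d_odd h; lia.
  apply: locB; first exact: l.
  apply: locMl; last by have := l 0%N; rewrite muln0.
  by apply: loc_leq (loc_bq _).
have key (F : fieldType) (a b c f g e : F) :
    a ^+ 2 * f - b ^+ 2 * g * (c ^+ 2 * e)
    = (a - b * c) * (a + b * c) * f + (b * c) ^+ 2 * (f - g * e) by ring.
have l6 k : loc 0 (vprod 6 k) by apply: loc_leq (loc_vprod _ _ _).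
have l2 k : loc 0 (vprod 2 k) by apply: loc_leq (loc_vprod _ co_d2 _).
rewrite /bq key; apply: locD.
  apply: locMr => //; apply: locMr; last by apply: locD => //; apply: locMl.
  exact: loc_vprod_cong.
apply: locMl; first by rewrite -(muln0 2); apply: locX; apply: locMl.
by rewrite mulnDr mulnCA; apply: loc_vprod_cong => //; apply: co_d2.
Qed.

End Summands.

(** * Sums of [c_q] and [a_q] modulo powers of Phi_d *)

Lemma q_neq0 : q != 0.
Proof. by rewrite tofrac_eq0 polyX_eq0. Qed.

Lemma qX_neq0 i : q ^+ i != 0.
Proof. by rewrite expf_neq0 // q_neq0. Qed.

Lemma vprodE s k :
  vprod s k = qpoch q (q ^+ 2) k / qpoch (q ^+ s) (q ^+ s) k.
Proof.
rewrite /vprod /qpoch -prodf_div; apply: eq_bigr => i _.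
by rewrite /vfactor -!exprM -exprS -exprD addn1 -mulnS.
Qed.

Lemma c_qE k :
  c_q k = bq k * ((1 - q ^+ (8 * k + 1)) / (1 - q)) * q ^+ (2 * k ^ 2).
Proof.
rewrite /c_q qintE; congr (_ * _ * _).
by rewrite /bq !vprodE expr_div_n mulf_div.
Qed.

Lemma qtermE y k :
  qterm q y k = (qpoch (q / y) (q ^+ 2) k * qpoch (q * y) (q ^+ 2) k
    / (qpoch (q ^+ 6 / y) (q ^+ 6) k * qpoch (q ^+ 6 * y) (q ^+ 6) k))
  * vprod 2 (2 * k) * (1 - q ^+ (8 * k + 1)) * q ^+ (2 * k ^ 2).
Proof.
rewrite /qterm vprodE.
have key (F : fieldType) (a b c e f g h i j : F) :
  a * b * c * e * f / (g * h * i) = a * b / (g * h) * (c / i) * e * f.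
  by rewrite !invfM; ring.
exact: key.
Qed.

Lemma sum_convolution (R : pzRingType) (f : nat -> R) n :
  \sum_(k < n) \sum_(j < k.+1) f j * f (k - j)%N
  = \sum_(i < n) f i * \sum_(j < n - i) f j.
Proof.
elim: n => [|n IH]; first by rewrite !big_ord0.
rewrite big_ord_recr /= IH [RHS]big_ord_recr /= subSnn big_ord1.
rewrite big_ord_recr /= subnn addrA; congr (_ + _); rewrite -big_split /=.
apply: eq_bigr => i _; rewrite -mulrDr; congr (_ * _).
by rewrite subSn ?big_ord_recr // ltnW.
Qed.

(** If 2r and 2s both exceed d, each weight is at least 2. Otherwise let 2s < d, so 2r > d: either
    4s > d and the weights are at least 2 and 1, or 4s < d, hence 4r > 3d and the weight of r is
    3. *)
Lemma wt_add d r s : odd d -> (r < d)%N -> (s < d)%N -> (d <= r + s)%N ->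
  (3 <= wt d r + wt d s)%N.
Proof. by rewrite /wt; lia. Qed.

(** For i = ud + r, the indices j added to reach a whole number of blocks lie in the last block and
    have residues d - r + t. *)
Lemma block_tail d m u r j : (r < d)%N -> (u < m)%N ->
  (d * m - (u * d + r) <= j)%N -> (j < d * (m - u))%N ->
  exists2 t, j = (d * (m - u).-1 + (d - r + t))%N & (t < r)%N.
Proof.
move=> rd um; rewrite -(subnKC um) addSnnS; move: (m - u.+1)%N => w.
rewrite addKn /= mulnDr mulnS => j1 j2.
by exists (j - (d * w + (d - r)))%N; lia.
Qed.

Lemma subqqX_neq0 m n : m != n -> q ^+ m - q ^+ n != 0.
Proof.
case: (ltngtP m n) => // [lt|gt] _.
  rewrite -(subnKC (ltnW lt)) exprD -{1}(mulr1 (q ^+ m)) -mulrBr.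
  by rewrite mulf_neq0 ?qX_neq0 // subqX_neq0 // subn_gt0.
rewrite -(subnKC (ltnW gt)) exprD -{2}(mulr1 (q ^+ n)) -mulrBr.
by rewrite mulf_neq0 ?qX_neq0 // -opprB oppr_eq0 subqX_neq0 // subn_gt0.
Qed.

Section Sums.

Variables (d : nat) (z : algC).
Hypothesis z_prim : d.-primitive_root z.
Hypotheses (d_gt1 : (1 < d)%N) (co_d6 : coprime d 6).

Local Notation loc := (loc d z).

Let d_gt0 : (0 < d)%N := ltnW d_gt1.

Lemma loc_subqV : loc 0 (1 - q)^-1.
Proof.
by rewrite -(expr1 q); apply: loc_subXnV => //; rewrite dvdn1 neq_ltn d_gt1 orbT.
Qed.

Lemma loc_cq k : loc (wt d (k %% d)) (c_q k).
Proof.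
rewrite c_qE; apply: locMr; last exact: loc_qX.
apply: locMr; first exact: loc_bq.
by apply: locMl; [apply: loc_subXn | apply: loc_subqV].
Qed.

Lemma loc_cq0 k : loc 0 (c_q k).
Proof. exact: loc_leq (loc_cq k). Qed.

(** Besides [loc_bq_cong], this uses that 8k + 1 and 2k^2 change by multiples of d when k does. *)
Lemma loc_cq_cong u r : (r < d)%N -> loc 1 (c_q (d * u + r) - bq (d * u) * c_q r).
Proof.
move=> rd; rewrite !c_qE.
have key (F : fieldType) (a b c x y x' y' w : F) :
  a * (x / w) * y - b * (c * (x' / w) * y')
  = (a - b * c) * ((x / w) * y) + b * c * ((x - x') * y + x' * (y - y')) * w^-1.
  by ring.
rewrite key; apply: locD.
  apply: locMr; first exact: loc_bq_cong.
  apply: locMl; last exact: loc_qX.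
  by apply: locMl; [apply: loc_subXn | apply: loc_subqV].
apply: locMr; last exact: loc_subqV.
have l0 k : loc 0 (bq k) by apply: loc_leq (loc_bq _ _ _ k).
apply: locMl; first exact: locMl.
apply: locD.
  apply: locMr; last exact: loc_qX.
  have e (F : fieldType) (x y : F) : (1 - x) - (1 - y) = - (x - y) by ring.
  rewrite e; apply: locN.
  rewrite (_ : 8 * (d * u + r) + 1 = 8 * r + 1 + d * (8 * u))%N; last by lia.
  exact: loc_qX_cong.
apply: locMl; first exact: loc_subXn.
rewrite (_ : 2 * (d * u + r) ^ 2 = 2 * r ^ 2 + d * (2 * u * (d * u + 2 * r)))%N.
  exact: loc_qX_cong.
by rewrite sqrnD; ring.
Qed.

Lemma loc_subqqV m : ~~ (d %| m)%N -> loc 0 (q ^+ d - q ^+ m)^-1.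
Proof.
move=> dm; case: (ltngtP d m) => [lt|gt|e]; last by rewrite e dvdnn in dm.
  rewrite -(subnKC (ltnW lt)) exprD -{1}(mulr1 (q ^+ d)) -mulrBr invfM.
  by apply: locMl; [apply: loc_qXV | apply: loc_subXnV => //; rewrite dvdn_subl // ltnW].
have -> : q ^+ d = q ^+ m * q ^+ (d - m) by rewrite -exprD (subnKC (ltnW gt)).
rewrite -{2}(mulr1 (q ^+ m)) -mulrBr -opprB mulrN invrN; apply: locN; rewrite invfM.
apply: locMl; [exact: loc_qXV | apply: loc_subXnV => //].
by rewrite dvdn_subr ?(ltnW gt).
Qed.

(** The counterpart of the square of [vfactor 6 k] in [qterm] at y = q^d. *)
Definition ufactor (k : nat) : ratfun :=
  (1 - q ^+ (2 * k + 1) / q ^+ d) * (1 - q ^+ (2 * k + 1) * q ^+ d)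
  / ((1 - q ^+ (6 * k.+1) / q ^+ d) * (1 - q ^+ (6 * k.+1) * q ^+ d)).

Lemma loc_ufactor_cong k : (k.+1 < d)%N -> loc 2 (vfactor 6 k ^+ 2 - ufactor k).
Proof.
move=> kd; have nd : ~~ (d %| 6 * k.+1)%N by rewrite dvd_scale // gtnNdvd.
(* The factor (1 - y)^2 arises from (1-a)^2 - (1 - a/y)(1 - ay) = a (1-y)^2 / y and its analogue for
   b. *)
have key (F : fieldType) (a b y : F) : y != 0 -> 1 - b != 0 -> y - b != 0 ->
    1 - b * y != 0 ->
    ((1 - a) / (1 - b)) ^+ 2 - (1 - a / y) * (1 - a * y) / ((1 - b / y) * (1 - b * y))
    = (1 - y) ^+ 2 * ((a - b) * (1 - a * b)) * (1 - b)^-1 ^+ 2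
      * (y - b)^-1 * (1 - b * y)^-1.
  by move=> y0 b0 yb by0; field; rewrite y0 b0 yb by0.
have yb : q ^+ d - q ^+ (6 * k.+1) != 0.
  by apply: subqqX_neq0; apply: contraNneq nd => <-.
have by0 : 1 - q ^+ (6 * k.+1) * q ^+ d != 0.
  by rewrite -exprD subqX_neq0 // addn_gt0 orbC d_gt0.
have b0 : 1 - q ^+ (6 * k.+1) != 0 by apply: subqX_neq0.
rewrite /vfactor /ufactor (key _ (q ^+ (2 * k + 1)) _ _ (qX_neq0 d) b0 yb by0).
have l : loc 0 (1 - q ^+ (6 * k.+1))^-1 by apply: loc_subXnV.
apply: locMr; last by rewrite -exprD; apply: loc_subXnV => //; rewrite dvdn_addl.
apply: locMr; last exact: loc_subqqV.
apply: locMr; last by rewrite -(muln0 2); apply: locX.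
apply: locMr; first by apply: (@locX _ _ 1); apply: loc_subXn_dvd.
by apply: locMl; [apply: locB; apply: loc_qX | rewrite -exprD; apply: loc_subXn].
Qed.

Lemma loc_vfactor6 k : (k.+1 < d)%N -> loc 0 (vfactor 6 k).
Proof. by move=> kd; apply: loc_vfactor => //; rewrite gtnNdvd. Qed.

(** Integrality of the product is carried along because the induction multiplies the new congruence
    by it. *)
Lemma loc_uprod_cong k : (k < d)%N ->
  loc 2 (vprod 6 k ^+ 2 - \prod_(i < k) ufactor i) /\ loc 0 (\prod_(i < k) ufactor i).
Proof.
elim: k => [|k IH] kd.
  rewrite vprod0 big_ord0 expr1n subrr; split; [exact: loc_0 | exact: loc_1].
have [IH2 IH0] := IH (ltnW kd); rewrite vprodS big_ord_recr /=.
have c := loc_ufactor_cong kd; have v := loc_vfactor6 kd.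
have v2 : loc 0 (vfactor 6 k ^+ 2) by rewrite -(muln0 2); apply: locX.
have u0 : loc 0 (ufactor k).
  by rewrite -(subKr (vfactor 6 k ^+ 2) (ufactor k)); apply: locB => //; apply: loc_leq c.
split; last exact: locMl.
have key (F : fieldType) (a b e f : F) :
  (a * b) ^+ 2 - e * f = (a ^+ 2 - e) * b ^+ 2 + e * (b ^+ 2 - f) by ring.
by rewrite key; apply: locD; [apply: locMr | apply: locMl].
Qed.

(** Only the squared factors differ; division by 1 - q turns 1 - q^(8k+1) into [8k+1]. *)
Lemma loc_cq_qterm k : (k < d)%N -> loc 2 (c_q k - qterm q (q ^+ d) k / (1 - q)).
Proof.
move=> kd; have [c _] := loc_uprod_cong kd.
have uE : qpoch (q / q ^+ d) (q ^+ 2) k * qpoch (q * q ^+ d) (q ^+ 2) k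
    / (qpoch (q ^+ 6 / q ^+ d) (q ^+ 6) k * qpoch (q ^+ 6 * q ^+ d) (q ^+ 6) k)
    = \prod_(i < k) ufactor i.
  rewrite /qpoch -!big_split /= -prodf_div; apply: eq_bigr => i _; rewrite /ufactor.
  have e1 y : q * y * (q ^+ 2) ^+ i = q ^+ (2 * i + 1) * y.
    by rewrite mulrAC -exprM -exprS addn1.
  have e6 y : q ^+ 6 * y * (q ^+ 6) ^+ i = q ^+ (6 * i.+1) * y.
    by rewrite mulrAC -exprM -exprD mulnS.
  by rewrite !e1 !e6.
rewrite c_qE qtermE uE /bq.
have key (F : fieldType) (a b f g h w : F) :
  a * b * (g / w) * h - f * b * g * h / w = (a - f) * (b * g * h) * w^-1 by ring.
rewrite key; apply: locMr; last exact: loc_subqV.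
apply: locMr => //; apply: locMr; last exact: loc_qX.
apply: locMl; last exact: loc_subXn.
exact: loc_leq (loc_vprod z_prim d_gt1 co_d6 (2 * k) (co_d2 co_d6) isT).
Qed.

Lemma sum_qterm_local : exists s : bool,
  (\sum_(k < d) qterm q (q ^+ d) k) / (1 - q) = (-1) ^+ s * q ^- d./2 * (qint d)%:F.
Proof.
have dd : (d < 2 * d)%N by lia.
have [s e] := sum_qterm subqX_neq0 q_neq0 co_d6 dd; exists s.
rewrite qintE mulrA; congr (_ / _); apply: (mulfI (qX_neq0 d./2)).
by rewrite e -mulrA mulrCA mulVKf // qX_neq0.
Qed.

Lemma loc_sign (s : bool) : loc 0 ((-1) ^+ s).
Proof. by case: s; [apply: locN; apply: loc_1 | apply: loc_1]. Qed.

Lemma loc_qint m : (d %| m)%N -> loc 1 (qint m)%:F.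
Proof.
by move=> dm; rewrite qintE; apply: locMr; [apply: loc_subXn_dvd | apply: loc_subqV].
Qed.

Lemma loc_sum_cq_cong s :
  (\sum_(k < d) qterm q (q ^+ d) k) / (1 - q) = (-1) ^+ s * q ^- d./2 * (qint d)%:F ->
  loc 2 (\sum_(k < d) c_q k - (-1) ^+ s * q ^- d./2 * (qint d)%:F).
Proof.
move=> <-; rewrite mulr_suml -sumrB; apply: loc_sum => k _.
exact: loc_cq_qterm.
Qed.

Lemma loc_sum_cq : loc 1 (\sum_(k < d) c_q k).
Proof.
have [s e] := sum_qterm_local; apply: loc_sub (loc_leq _ (loc_sum_cq_cong e)) _ => //.
apply: locMl; last by apply: loc_qint.
by apply: locMl; [apply: loc_sign | apply: loc_qXV].
Qed.

Lemma loc_sum_cq_blocks m : loc 1 (\sum_(k < d * m) c_q k).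
Proof.
elim: m => [|m IH]; first by rewrite muln0 big_ord0; apply: loc_0.
rewrite mulnS addnC big_split_ord /=; apply: locD => //.
apply: (@loc_sub _ _ _ _ (\sum_(r < d) bq (d * m) * c_q r)).
  by rewrite -sumrB; apply: loc_sum => r _; apply: loc_cq_cong.
rewrite -mulr_sumr; apply: locMl; last exact: loc_sum_cq.
exact: loc_leq (loc_bq _ _ _ _).
Qed.

Lemma loc_sum_aq m :
  loc 3 (\sum_(k < d * m) a_q k
    - \sum_(i < d * m) c_q i * \sum_(j < d * (m - i %/ d)) c_q j).
Proof.
rewrite /a_q sum_convolution -sumrB; apply: loc_sum => i _.
rewrite -opprB; apply: locN; rewrite -mulrBr.
set u := (i %/ d)%N; set r := (i %% d)%N.
have iE : nat_of_ord i = (u * d + r)%N by apply: divn_eq.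
have rd : (r < d)%N by rewrite ltn_pmod.
have um : (u < m)%N by rewrite ltn_divLR // (mulnC m).
have le : (d * m - i <= d * (m - u))%N by rewrite iE mulnBr; lia.
(* Only the indices from dm - i up to d(m - u) remain, each weighted by c_q(i); [block_tail] and
   [wt_add] give exponent 3 for every such product. *)
rewrite -!(big_mkord xpredT c_q) (big_cat_nat (leq0n _) le) /= addrAC subrr add0r.
rewrite mulr_sumr.
rewrite big_nat_cond; apply: loc_sum => j; rewrite andbT => /andP[j1 j2].
have [t jE tr] : exists2 t, j = (d * (m - u).-1 + (d - r + t))%N & (t < r)%N.
  by apply: block_tail => //; rewrite -iE.
apply: (@loc_leq _ _ (wt d (i %% d) + wt d (j %% d))).
  have jr : (j %% d = d - r + t)%N by rewrite jE mulnC modnMDl modn_small //; lia.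
  apply: wt_add => //; first exact: (d_odd co_d6).
  - exact: ltn_pmod.
  - by rewrite jr -/r; lia.
by apply: locM; apply: loc_cq.
Qed.

Lemma loc_sum_aq_dvd m : loc 1 (\sum_(k < d * m) a_q k).
Proof.
apply: loc_sub (loc_leq _ (loc_sum_aq m)) _ => //.
apply: loc_sum => i _; apply: locMl; first exact: loc_cq0.
exact: loc_sum_cq_blocks.
Qed.

(** With S the sum of [c_q] and T its value modulo Phi_d^2, S^2 - T^2 = (S - T)((S - T) + 2T), where
    the first factor has exponent 2 and the second exponent 1. *)
Lemma loc_sum_aq_cong :
  loc 3 (\sum_(k < d) a_q k - q ^- (d - 1) * (qint d)%:F ^+ 2).
Proof.
have := loc_sum_aq 1; rewrite muln1.
rewrite [X in _ - X](eq_bigr (fun i : 'I_d => c_q i * \sum_(j < d) c_q j)); last first.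
  by move=> i _; rewrite divn_small // subn0 muln1.
rewrite -mulr_suml => h.
have [s e] := sum_qterm_local; have c := loc_sum_cq_cong e.
(* Squaring removes the unknown sign, and d odd gives 2 (d-1)/2 = d - 1. *)
have -> : q ^- (d - 1) * (qint d)%:F ^+ 2 = ((-1) ^+ s * q ^- d./2 * (qint d)%:F) ^+ 2.
  rewrite !exprMn sqrr_sign mul1r exprVn -exprM muln2.
  have -> // : (d - 1 = d./2.*2)%N.
  by rewrite -{1}(odd_double_half d) (d_odd co_d6) addKn.
have lT : loc 1 ((-1) ^+ s * q ^- d./2 * (qint d)%:F).
  apply: locMl; last by apply: loc_qint.
  by apply: locMl; [apply: loc_sign | apply: loc_qXV].
move: h c lT; move: (\sum_(k < d) a_q k) (\sum_(k < d) c_q k)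
  ((-1) ^+ s * q ^- d./2 * (qint d)%:F) => A S T h c lT.
have key (F : fieldType) (a x y : F) :
  a - y ^+ 2 = (a - x * x) + (x - y) * ((x - y) + (y + y)) by ring.
rewrite (key _ A S T); apply: locD => //; apply: (@locM _ _ 2 1) => //.
by apply: locD; [apply: loc_leq c | apply: locD].
Qed.

End Sums.

(** * From local to global congruences *)

Lemma prim_root_family : exists zs : nat -> algC,
  forall d, (0 < d)%N -> d.-primitive_root (zs d).
Proof.
(* The value 0 at d = 0 is a mere default. *)
exists (fun d => if d is d'.+1 then sval (C_prim_root_exists (ltn0Sn d')) else 0).
by case=> // d _; case: (C_prim_root_exists (ltn0Sn d)).
Qed.

Lemma Cyclotomic_neq0 d : 'Phi_d != 0 :> {poly int}.
Proof. by rewrite monic_neq0 ?Cyclotomic_monic. Qed.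

(** One Phi_d is removed at a time: [A * E] vanishes at z and [E] does not, so [A] does. *)
Lemma zdvdp_Cyclotomic_exp d (z : algC) e A E : d.-primitive_root z -> evz z E != 0 ->
  zdvdp ('Phi_d ^+ e) (A * E) -> zdvdp ('Phi_d ^+ e) A.
Proof.
move=> zP E0; elim: e A => [|e IH] A [B hB]; first by exists A; rewrite mul1r.
have [|A' hA] := @evz_eq0 _ _ zP A.
  apply: (mulIf E0); rewrite mul0r -evzM hB exprS -mulrA evzM.
  by rewrite (evz_Cyclotomic zP) mul0r.
have [|C hC] := IH A'.
  by exists B; apply: (mulfI (Cyclotomic_neq0 d)); rewrite mulrA -hA hB exprS mulrA.
by exists C; rewrite hA hC exprS mulrA.
Qed.

(** A common root would be primitive of both orders, so each order would divide the other. *)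
Lemma evz_Cyclotomic_neq0 d d' (z z' : algC) :
  d.-primitive_root z -> d'.-primitive_root z' ->
  d != d' -> evz z 'Phi_d' != 0.
Proof.
move=> zP z'P; apply: contraNneq => /rootP.
rewrite (Cintr_Cyclotomic z'P) root_cyclotomic // => zP'.
by rewrite eqn_dvd (prim_order_dvd zP) (prim_expr_order zP') eqxx
  (prim_order_dvd zP') (prim_expr_order zP) eqxx.
Qed.

Lemma frac_cross_mul (A B C E : {poly int}) : B != 0 -> E != 0 ->
  A%:F / B%:F = C%:F / E%:F :> ratfun -> A * E = C * B.
Proof.
rewrite -(tofrac_eq0 B) -(tofrac_eq0 E) => B0 E0 h; apply/eqP.
have key (F : fieldType) (a b c e : F) : b != 0 -> e != 0 -> a / b = c / e ->
  a * e = c * b.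
  by move=> b0 e0 /eqP; rewrite eqr_div // => /eqP.
by rewrite -tofrac_eq !tofracM (key _ _ _ _ _ B0 E0 h).
Qed.

Section Combine.

Variable zs : nat -> algC.
Hypothesis zsP : forall d, (0 < d)%N -> d.-primitive_root (zs d).

(** Each d comes with its own fraction for x, whereas the global congruence needs a single one whose
    denominator is prime to all the Phi_d. *)
Lemma loc_common_frac (s : seq nat) (x : ratfun) :
  s != [::] -> all (leq 1) s -> (forall d, d \in s -> loc d (zs d) 0 x) ->
  exists A B : {poly int}, [/\ B != 0, x = A%:F / B%:F &
    forall d, d \in s -> evz (zs d) B != 0].
Proof.
elim: s => // d s IH _ /= /andP[d0 s0] hx; have zP := zsP d0.
have [C [E [xE' E0]]] := hx d (mem_head _ _); rewrite mul1r in xE'.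
have [A [B [B0 xE hB]]] : exists A B : {poly int}, [/\ B != 0, x = A%:F / B%:F &
    forall d, d \in s -> evz (zs d) B != 0].
  have [->|s1] := eqVneq s [::].
    by exists C, E; split=> //; rewrite -(tofrac_eq0 E) (evz_neq0 E0).
  by apply: IH => // d' d's; apply: hx; rewrite inE d's orbT.
(* Descent on the degree of [B]: if [B] vanishes at [zs d], then by cross-multiplication with C / E
   so does [A], and Phi_d cancels from both. *)
have [m sB] := ubnP (size B); elim: m => // m IHm in A B B0 xE hB sB *.
have [Bz|Bz] := eqVneq (evz (zs d) B) 0; last first.
  by exists A, B; split=> // d'; rewrite inE => /predU1P[->|/hB].
have [B' BE] := evz_eq0 zP Bz.
have AE : A * E = C * B.
  apply: frac_cross_mul; rewrite -?xE' -?xE // -(tofrac_eq0 E).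
  exact: evz_neq0 E0.
have [|A' AE'] := @evz_eq0 _ _ zP A.
  by apply: (mulIf E0); rewrite mul0r -evzM AE evzM Bz mulr0.
have P0 := Cyclotomic_neq0 d.
have B'0 : B' != 0 by apply: contraNneq B0 => B'0; rewrite BE B'0 mulr0.
apply: (IHm A' B') => //.
- rewrite xE AE' BE !tofracM -mulf_div divff ?mul1r // tofrac_eq0 //.
- by move=> d' /hB; rewrite BE evzM mulf_eq0 negb_or => /andP[].
- move: sB; rewrite BE size_mul // size_Cyclotomic.
  have : (0 < totient d)%N by rewrite totient_gt0.
  move: (size B') (totient d); lia.
Qed.

(** After division by the other powers, Phi_d^(e d) still divides the quotient, since they do not
    vanish at [zs d]. *)
Lemma zdvdp_prod_Cyclotomic (s : seq nat) (e : nat -> nat) A :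
  uniq s -> all (leq 1) s -> (forall d, d \in s -> zdvdp ('Phi_d ^+ e d) A) ->
  zdvdp (\prod_(d <- s) 'Phi_d ^+ e d) A.
Proof.
elim: s => [|d s IH] /=; first by move=> _ _ _; exists A; rewrite big_nil mul1r.
move=> /andP[ds us] /andP[d0 s0] h; rewrite big_cons.
have [|C hC] := IH us s0; first by move=> d' d's; apply: h; rewrite inE d's orbT.
have [||C' hC'] := @zdvdp_Cyclotomic_exp d (zs d) (e d) C
    (\prod_(d <- s) 'Phi_d ^+ e d) (zsP d0).
- rewrite big_seq; elim/big_ind: _ => [|a b a0 b0|d' d's].
  + by rewrite /evz rmorph1 hornerE oner_neq0.
  + by rewrite evzM mulf_neq0.
  + rewrite /evz rmorphXn horner_exp expf_neq0 //.
    apply: (evz_Cyclotomic_neq0 (zsP d0) (zsP (allP s0 _ d's))).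
    by apply: contraNneq ds => ->.
- by rewrite mulrC -hC; apply: h; rewrite mem_head.
by exists C'; rewrite hC hC' mulrA (mulrC ('Phi_d ^+ _)) .
Qed.

(** A common divisor [D] vanishes at no [zs d], so every cyclotomic power can be struck from the
    product that it divides; finally [D] divides 1 in Z[q], which also excludes integer factors. *)
Lemma zcoprimep_prod_Cyclotomic (s : seq nat) (e : nat -> nat) B :
  all (leq 1) s -> (forall d, d \in s -> evz (zs d) B != 0) ->
  zcoprimep (\prod_(d <- s) 'Phi_d ^+ e d) B.
Proof.
move=> s0 hB D DP [E BE].
have {B E hB BE} hD d : d \in s -> evz (zs d) D != 0.
  by move=> /hB; rewrite BE evzM mulf_eq0 negb_or => /andP[].
elim: s s0 hD DP => [|d s IH] /=.
  by rewrite big_nil => _ _ [E hE]; apply/unitrPr; exists E.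
move=> /andP[d0 s0] hD [E]; rewrite big_cons => hE.
apply: IH => // [d' d's|]; first by apply: hD; rewrite inE d's orbT.
have [|E' E'E] := @zdvdp_Cyclotomic_exp d (zs d) (e d) E D (zsP d0) (hD d (mem_head _ _)).
  by exists (\prod_(d <- s) 'Phi_d ^+ e d); rewrite mulrC hE.
exists E'; apply: (mulfI (expf_neq0 (e d) (Cyclotomic_neq0 d))).
by rewrite hE E'E mulrCA.
Qed.

Lemma ratfun_eq0_mod_prod (s : seq nat) (e : nat -> nat) (x : ratfun) :
  s != [::] -> uniq s -> all (leq 1) s -> (forall d, d \in s -> loc d (zs d) (e d) x) ->
  ratfun_eq0_mod (\prod_(d <- s) 'Phi_d ^+ e d) x.
Proof.
move=> s1 us s0 hx.
have [|A [B [B0 xE hB]]] := @loc_common_frac s x s1 s0.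
  by move=> d ds; apply: loc_leq (hx d ds).
exists A, B; split=> //; last exact: zcoprimep_prod_Cyclotomic.
apply: zdvdp_prod_Cyclotomic => // d ds.
have [C [E [xE' E0]]] := hx d ds.
have zP := zsP (allP s0 _ ds).
apply: (zdvdp_Cyclotomic_exp (E := E) zP E0).
exists (C * B); rewrite mulrA; apply: frac_cross_mul; rewrite -?xE' -?xE //.
by rewrite -(tofrac_eq0 E); apply: evz_neq0 E0.
Qed.

End Combine.

(** * Factorization of the modulus and conclusion *)

Lemma Cyclotomic1 : 'Phi_1 = 'X - 1 :> {poly int}.
Proof. by have := @prod_Cyclotomic 1 isT; rewrite big_seq1. Qed.

(** The factor Phi_1 = X - 1 is cancelled from the factorization of X^n - 1. *)
Lemma qint_prod_Cyclotomic n : (0 < n)%N ->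
  qint n = \prod_(d <- divisors n | (1 < d)%N) 'Phi_d.
Proof.
move=> n0; apply: (@mulfI _ ('X - 1)); first by rewrite -Cyclotomic1 Cyclotomic_neq0.
rewrite -subrX1 -prod_Cyclotomic // (bigD1_seq 1%N) /= ?divisors_uniq //; last first.
  by rewrite -dvdn_divisors // dvd1n.
rewrite Cyclotomic1; congr (_ * _); rewrite big_seq_cond [RHS]big_seq_cond.
apply: eq_bigl => d; apply: andb_id2l; rewrite -dvdn_divisors // => /dvdn_gt0-/(_ n0).
by case: d => [|[|]].
Qed.

Lemma qint_modulus n : (1 < n)%N ->
  qint n * 'Phi_n ^+ 2
  = \prod_(d <- [seq d <- divisors n | (1 < d)%N]) 'Phi_d ^+ (if d == n then 3 else 1).
Proof.
move=> n1; have n0 := ltnW n1.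
have nd : n \in divisors n by rewrite -dvdn_divisors.
rewrite qint_prod_Cyclotomic // big_filter.
rewrite -!(big_filter (divisors n)).
have nf : n \in [seq d <- divisors n | (1 < d)%N] by rewrite mem_filter n1.
have uf : uniq [seq d <- divisors n | (1 < d)%N] by rewrite filter_uniq ?divisors_uniq.
rewrite !(bigD1_seq n nf uf) /= eqxx mulrAC -exprS; congr (_ * _).
by apply: eq_bigr => d /negPf ->.
Qed.

Lemma c_q0 : c_q 0 = 1.
Proof.
rewrite c_qE /bq !muln0 !vprod0 expr0 expr1n !mulr1 mul1r divff // -(expr1 q).
exact: subqX_neq0.
Qed.

Theorem theorem4 (n : nat) (n_gt0 : (0 < n)%N) (co_n6 : coprime n 6) :
  ratfun_eq_mod (qint n * 'Phi_n ^+ 2)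
    (\sum_(k < n) a_q k)
    (q ^- (n - 1) * (qint n)%:F ^+ 2).
Proof.
rewrite /ratfun_eq_mod; have [n1|n1] := ltnP 1 n; last first.
  have -> : n = 1%N by apply/eqP; rewrite eqn_leq n1.
  exists 0, 1; split.
  - exact: oner_neq0.
  - rewrite tofrac0 mul0r big_ord1 /a_q big_ord1 c_q0 mul1r /qint big_ord1.
    by rewrite !expr0 tofrac1 expr1n invr1 mul1r subrr.
  - by exists 0; rewrite mulr0.
  - by move=> D _ [E hE]; apply/unitrPr; exists E.
rewrite qint_modulus //; have [zs zsP] := prim_root_family.
apply: (ratfun_eq0_mod_prod zsP).
- apply/eqP => s0; have : n \in [seq d <- divisors n | (1 < d)%N].
    by rewrite mem_filter n1 -dvdn_divisors ?dvdnn.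
  by rewrite s0.
- by rewrite filter_uniq ?divisors_uniq.
- by apply/allP => d; rewrite mem_filter => /andP[/ltnW].
move=> d; rewrite mem_filter -dvdn_divisors // => /andP[d1 dn].
have zP := zsP d (ltnW d1).
have co_d6 : coprime d 6 by apply: coprime_dvdl co_n6.
(* The full exponent 3 is required at d = n only. At a proper divisor, both sides vanish modulo
   Phi_d. *)
case: eqP => [e|_].
  by subst d; apply: loc_sum_aq_cong.
apply: locB.
  by move: dn => /dvdnP[m ->]; rewrite mulnC; apply: loc_sum_aq_dvd.
apply: locMl; first exact: loc_qXV.
by apply: (@loc_leq _ _ (2 * 1)) => //; apply: locX; apply: loc_qint.
Qed.
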